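(* There exists an absolute constant $\mu>0$ such that the following holds for all positive integers $m,d$ and all real $t\ge 0$. Let ${\bf N}\in\mathbb{R}^{m\times m\times\dots\times m}$ be a $d$-dimensional random tensor whose $m^d$ elements are i.i.d. standard normal random variables. Then $$\mathbb{P}\Big\{\sup_{\mathrm{rank}({\bf V})\le 2,\ \|{\bf V}\|_F=1}({\bf N},{\bf V})_F>\mu\sqrt{m d^2\ln m}+t\Big\}\le e^{-\frac{t^2}{4}}+2e^{-\frac{m^{d/2}}{8}},$$ where the supremum is over all tensors ${\bf V}\in\mathbb{R}^{m\times m\times\dots\times m}$ ($d$ dimensions) of canonical rank at most $2$ and unit Frobenius norm.
   Context: $(\cdot,\cdot)_F$ is the Frobenius (entrywise Euclidean) inner product of real tensors and $\|\cdot\|_F$ is the corresponding norm. The canonical rank of a $d$-dimensional tensor is the least number of elementary tensors $u^{(1)}\otimes\dots\otimes u^{(d)}$ with $u^{(s)}\in\mathbb{R}^{m}$ whose sum equals the tensor. ''Absolute constant'' means independent of $m$, $d$, $t$. *)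

(* Defs.v *)
From HB Require Import structures.
From mathcomp Require Import all_boot all_order all_algebra.
From mathcomp Require Import all_classical all_reals all_analysis.

Set Implicit Arguments.
Unset Strict Implicit.
Unset Printing Implicit Defensive.

Import Order.TTheory GRing.Theory Num.Theory.

Local Open Scope classical_set_scope.
Local Open Scope ring_scope.

Notation tensor R m d := {ffun {ffun 'I_d -> 'I_m} -> R}.

Section Tensors.
Context {R : realType} {m d : nat}.
Implicit Types V W : tensor R m d.

Definition frob_inner V W : R := \sum_i V i * W i.

Definition frob_norm V : R := Num.sqrt (frob_inner V V).

Definition elementary (u : 'I_d -> 'rV[R]_m) : tensor R m d :=
  [ffun i : {ffun 'I_d -> 'I_m} => \prod_s u s ord0 (i s)].

Definition sum_of_elementary V (r : nat) : Prop :=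
  exists u : 'I_r -> 'I_d -> 'rV[R]_m, V = \sum_(k < r) elementary (u k).

(* The default value 0 is only reached when [V] is not a finite sum of
   elementary tensors, which requires [d = 0]: see [canonical_rankP]. *)
Definition canonical_rank V : nat :=
  xget 0%N [set r | sum_of_elementary V r /\
                    forall k, sum_of_elementary V k -> (r <= k)%N].

Lemma sum_of_elementary_ex V : (0 < d)%N -> exists r, sum_of_elementary V r.
Proof.
move=> d0; pose s0 : 'I_d := Ordinal d0.
pose I := {ffun 'I_d -> 'I_m} : finType.
pose w (i : I) (s : 'I_d) : 'rV[R]_m :=
  \row_j ((if s == s0 then V i else 1) * (j == i s)%:R).
exists #|I|, (fun k => w (enum_val k)).
rewrite -(big_enum_val (fun i => elementary (w i))) /=.
apply/ffunP => i; rewrite sum_ffunE (bigD1 i)//= big1 ?addr0.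
  rewrite ffunE (bigD1 s0)//= mxE !eqxx mulr1 big1 ?mulr1// => s /negbTE ss0.
  by rewrite mxE ss0 eqxx mulr1.
move=> j ji; rewrite ffunE.
have [s] : exists s, i s != j s.
  apply/existsP; rewrite -negb_forall; apply: contra ji => /forallP ij.
  by apply/eqP/ffunP => s; apply/esym/eqP/ij.
by move=> /negbTE ijs; rewrite (bigD1 s)//= mxE ijs mulr0 mul0r.
Qed.

Lemma canonical_rankP V : (0 < d)%N ->
  sum_of_elementary V (canonical_rank V) /\
  forall k, sum_of_elementary V k -> (canonical_rank V <= k)%N.
Proof.
move=> d0; have [r Vr] := sum_of_elementary_ex V d0.
rewrite /canonical_rank; case: xgetP => [_ _ //|noleast]; exfalso.
have exr : exists r, `[< sum_of_elementary V r >] by exists r; apply/asboolP.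
case: (ex_minnP exr) => n /asboolP Vn nmin; apply: (noleast n); split=> // k Vk.
by apply: nmin; apply/asboolP.
Qed.

End Tensors.

Section RandomVariables.
Context {dT : measure_display} {T : measurableType dT} {R : realType}.
Context {P : probability T R}.

Definition mutually_independent (I : finType) (X : I -> {RV P >-> R}) : Prop :=
  forall (J : {set I}) (B : I -> set R), (forall i, measurable (B i)) ->
    P (\bigcap_(i in [set` J]) (X i @^-1` B i)) =
    (\prod_(i in J) P (X i @^-1` B i))%E.

(* Laws are compared on measurable sets only: off the sigma-algebra, the values
   of [distribution] and [normal_prob] are irrelevant. *)
Definition standard_normal (X : {RV P >-> R}) : Prop :=
  forall B : set R, measurable B -> distribution P X B = normal_prob 0 1 B.

Definition iid_standard_normal (I : finType) (X : I -> {RV P >-> R}) : Prop :=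
  mutually_independent X /\ forall i, standard_normal (X i).

End RandomVariables.

Definition random_tensor {dT : measure_display} {T : measurableType dT}
    {R : realType} {P : probability T R} {m d : nat}
    (N : {ffun 'I_d -> 'I_m} -> {RV P >-> R}) (w : T) : tensor R m d :=
  [ffun i => N i w].

(* Taken in [\bar R] because [sup] on [R] is 0 on unbounded sets. *)
Definition sup_low_rank {R : realType} {m d : nat} (r : nat)
    (A : tensor R m d) : \bar R :=
  ereal_sup [set (frob_inner A V)%:E | V in
    [set V : tensor R m d | (canonical_rank V <= r)%N /\ frob_norm V = 1]].

(* Main.v *)
Require Import Defs.
From HB Require Import structures.
From mathcomp Require Import all_boot all_order all_algebra.
From mathcomp Require Import all_classical all_reals all_analysis.
From mathcomp Require Import measurable_realfun.
From mathcomp Require Import ring lra zify.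

(** The bound is a union bound over a finite net. What makes a net possible is
that the unit tensors of rank at most 2 have a parametrization by bounded
vectors, although the two elementary terms of such a tensor may be arbitrarily
large and nearly cancel.

Write [V = al U + be W] with [U], [W] elementary products of unit vectors [u_s]
and [v_s], and let [c_s = <u_s, v_s>], [C = <U, W> = \prod_s c_s]. Then
[1 = |V|^2 = (al + be C)^2 + be^2 (1 - C^2)] and [C^2 <= c_s^2 <= 1]. With
[p_s = c_s u_s], the product of the [p_s] is [C U], and
[V = (al + be C) U + be (W - C U)]. Telescoping the last difference one factor
at a time gives
[V = (al + be C) U + \sum_s v_1 ... v_(s-1) y_s p_(s+1) ... p_d] with
[y_s = be (v_s - p_s)]. Here [|y_s|^2 = be^2 (1 - c_s^2) <= be^2 (1 - C^2) <= 1],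
however large [be] is: every vector in this expression has entries in
[[-1, 1]] ([rank2_chart_cover]).

Let [n = m^d]. Rounding the [4 d m] entries to a grid of step [1 / (2 n^4)] moves
each entry of [V] by at most [1 / (2 n^2)] ([net_approx]), so the net has
[n^O(d m) = exp (O (m d^2 ln m))] points, and its points can be taken of squared
norm at most 2. If all entries of [N] are at most [2 n] in absolute value,
rounding changes [(N, V)] by at most 1 ([sup_low_rank_le_net]); otherwise an
event of probability at most [2 n exp (- 2 n^2)] occurs, which is what the term
[2 exp (- m^(d/2) / 8)] pays for. On the net, each [(N, W)] has tail
[exp (- s^2 / 4)] ([gaussian_linear_tail]); the level
[s = mu sqrt (m d^2 ln m) + t - 1] absorbs the cardinality of the net and leaves
[exp (- t^2 / 4)] ([net_tail_le]).

On the probabilistic side, the tail of a linear combination of independent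
normal variables comes from the moment generating function, hence from the
product rule for expectations ([expectation_prod_indep]). *)

Import Order.TTheory GRing.Theory Num.Theory.
Import numFieldNormedType.Exports.

Local Open Scope classical_set_scope.
Local Open Scope ring_scope.

Set Implicit Arguments.
Unset Strict Implicit.

(** * Change of measure *)

Section ChangeOfMeasure.
Context {d1 d2 : measure_display} {T : measurableType d1} {U : measurableType d2}
  {R : realType}.
Import HBNNSimple.

(** The claim is linear in [f], so it passes from indicators to simple functions,
then to all nonnegative functions by monotone convergence. It serves both for the normal
density and, with [h] a product of functions of other variables, for
independence. *)
Lemma ge0_integral_density (mu : {measure set T -> \bar R})
    (nu : {measure set U -> \bar R}) (phi : T -> U) (h : T -> R) (f : U -> R) :
  measurable_fun setT phi -> measurable_fun setT h -> (forall x, 0 <= h x) ->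
  (forall B, measurable B ->
    nu B = (\int[mu]_x (\1_B (phi x) * h x)%:E)%E) ->
  measurable_fun setT f -> (forall y, 0 <= f y) ->
  (\int[nu]_y (f y)%:E = \int[mu]_x (f (phi x) * h x)%:E)%E.
Proof.
move=> mphi mh h0 nuE mf f0.
have mF : measurable_fun setT (EFin \o f) by exact/measurable_EFinP.
pose g := nnsfun_approx measurableT mF.
have gf y : EFin \o g^~ y @ \oo --> (f y)%:E.
  by apply: cvg_nnsfun_approx => // z _; rewrite lee_fin.
have gnd y : {homo g^~ y : a b / (a <= b)%N >-> a <= b}.
  by move=> a b ab; exact/lefP/nd_nnsfun_approx.
have step n : (\int[nu]_y (g n y)%:E = \int[mu]_x (g n (phi x) * h x)%:E)%E.
  have y0 y x : 0 <= y * \1_(g n @^-1` [set y]) x.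
    by rewrite -lee_fin; exact: nnfun_muleindic_ge0.
  transitivity (\int[nu]_x
      (\sum_(y \in range (g n)) (y * \1_(g n @^-1` [set y]) x)%:E))%E.
    by apply: eq_integral => x _; rewrite fimfunE -fsumEFin.
  rewrite ge0_integral_fsum//; last 2 first.
  - by move=> y; apply/measurable_EFinP; exact: measurable_funM.
  - by move=> y x _; rewrite lee_fin.
  transitivity (\int[mu]_x (\sum_(y \in range (g n))
      (y * \1_(g n @^-1` [set y]) (phi x) * h x)%:E))%E; last first.
    apply: eq_integral => x _; rewrite fsumEFin//; congr EFin.
    rewrite (fimfunE (g n) (phi x)) !fsbig_finite//=.
    by rewrite big_distrl.
  have mind y : measurable_fun setT
      (fun x => \1_(g n @^-1` [set y]) (phi x) * h x).
    by apply: measurable_funM => //; apply: measurableT_comp.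
  rewrite ge0_integral_fsum//; last 2 first.
  - move=> y; apply/measurable_EFinP.
    under eq_fun do rewrite -mulrA.
    exact: measurable_funM.
  - by move=> y x _; rewrite lee_fin mulr_ge0.
  apply: eq_fsbigr => y; rewrite inE => -[z _ gz].
  have y_ge0 : 0 <= y by rewrite -gz.
  under eq_integral do rewrite EFinM.
  rewrite ge0_integralZl//; last exact/measurable_EFinP.
  rewrite integral_indic// setIT nuE//.
  under [in RHS]eq_integral do rewrite -mulrA EFinM.
  rewrite ge0_integralZl//; first exact/measurable_EFinP.
  by move=> x _; rewrite lee_fin mulr_ge0.
have cvgl : (\int[nu]_y (g n y)%:E)%E @[n --> \oo] --> (\int[nu]_y (f y)%:E)%E.
  have -> : (\int[nu]_y (f y)%:E = \int[nu]_y limn (fun n => (g n y)%:E))%E.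
    by apply: eq_integral => y _; apply/esym/cvg_lim => //; exact: gf.
  apply: cvg_monotone_convergence => //.
  - by move=> n; exact/measurable_EFinP.
  - by move=> n y _; rewrite lee_fin.
  - by move=> y _ a b ab; rewrite lee_fin gnd.
have cvgr : (\int[nu]_y (g n y)%:E)%E @[n --> \oo] -->
    (\int[mu]_x (f (phi x) * h x)%:E)%E.
  under eq_fun do rewrite step.
  have -> : (\int[mu]_x (f (phi x) * h x)%:E =
      \int[mu]_x limn (fun n => (g n (phi x) * h x)%:E))%E.
    apply: eq_integral => x _; apply/esym/cvg_lim => //.
    under eq_fun do rewrite EFinM.
    by rewrite EFinM; apply: cvgeZr => //; exact: gf.
  apply: cvg_monotone_convergence => //.
  - move=> n; apply/measurable_EFinP; apply: measurable_funM => //.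
    exact: measurableT_comp.
  - by move=> n x _; rewrite lee_fin mulr_ge0.
  - by move=> x _ a b ab; rewrite lee_fin ler_wpM2r// gnd.
by apply: (cvg_unique _ cvgl cvgr).
Qed.

End ChangeOfMeasure.

Lemma ge0_integral_normal_law {R : realType} (m s : R)
    (nu : {measure set R -> \bar R}) (f : R -> R) :
  (forall B : set R, measurable B -> nu B = normal_prob m s B) ->
  measurable_fun setT f -> (forall x, 0 <= f x) ->
  (\int[nu]_x (f x)%:E =
   \int[lebesgue_measure]_x (f x * normal_pdf m s x)%:E)%E.
Proof.
move=> nuE mf f0.
apply: (@ge0_integral_density _ _ _ _ R lebesgue_measure nu
  idfun (normal_pdf m s)) => //.
- exact: measurable_id.
- exact: measurable_normal_pdf.
- by move=> x; exact: normal_pdf_ge0.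
move=> B mB; rewrite nuE// /normal_prob [LHS]integral_mkcond/=.
apply: eq_integral => x _; rewrite patchE indicE.
by case: ifPn => xB; rewrite ?mul1r ?mul0r.
Qed.

(** * Expectations of products of independent variables *)

Section Independence.
Context {dT : measure_display} {T : measurableType dT} {R : realType}
  {P : probability T R}.

(** Independence is the case where all [f i] are indicators. Indicators are
replaced by general functions one index at a time: when every factor but the
[k]-th is fixed, both sides depend on the indicator of [B] in position [k] as
measures in [B], so [ge0_integral_density] extends their equality to functions.
Finiteness of the expectations makes the constant in front of the law of [X k]
a real number. *)
Lemma expectation_prod_indep (I : finType) (X : I -> {RV P >-> R})
    (f : I -> R -> R) :
  mutually_independent X ->
  (forall i, measurable_fun setT (f i)) -> (forall i x, 0 <= f i x) ->
  (forall i, (\int[P]_w (f i (X i w))%:E < +oo)%E) ->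
  (\int[P]_w (\prod_i f i (X i w))%:E = \prod_i \int[P]_w (f i (X i w))%:E)%E.
Proof.
move=> indX.
(* [s] lists the indices at which indicators have already been replaced. *)
suff H (s : seq I) : forall f : I -> R -> R,
    (forall i, measurable_fun setT (f i)) -> (forall i x, 0 <= f i x) ->
    (forall i, (\int[P]_w (f i (X i w))%:E < +oo)%E) ->
    (forall i, i \notin s ->
       exists2 B : set R, measurable B & f i = \1_B) ->
    (\int[P]_w (\prod_i f i (X i w))%:E =
     \prod_i \int[P]_w (f i (X i w))%:E)%E.
  move=> mf f0 ffin; apply: (H (enum I)) => // i.
  by rewrite mem_enum.
elim: s => {f} [|k s IH] f mf f0 ffin find.
  have {find} /choice[B fB] : forall i, exists B : set R,
      measurable B /\ f i = \1_B.
    by move=> i; have [//|B mB fB] := find i; exists B.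
  have mB i : measurable (B i) by case: (fB i).
  have mXB i : measurable (X i @^-1` B i).
    by rewrite -[_ @^-1` _]setTI; exact: measurable_funPT.
  have fE i : f i = \1_(B i) by case: (fB i).
  transitivity (P (\bigcap_(i in [set` [set: I]%SET]) (X i @^-1` B i))).
    rewrite -[X in _ = P X]setIT -integral_indic//; last first.
      by apply: fin_bigcap_measurable.
    apply: eq_integral => w _; congr EFin; rewrite indicE.
    have [wB|wB] := boolP (w \in _).
      rewrite big1// => i _; rewrite fE indicE mem_set//.
      by move: wB; rewrite inE => /(_ i); apply; rewrite /= inE.
    have [i wi] : exists i, ~ B i (X i w).
      apply: contrapT => /forallNP h; move/negP: wB; apply.
      by rewrite inE => i _; exact: contrapT (h i).
    by rewrite (bigD1 i)//= fE indicE memNset// mul0r.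
  rewrite indX//.
  rewrite (eq_bigl xpredT); last by move=> i; rewrite inE.
  apply: eq_bigr => i _; rewrite fE.
  by rewrite -[X in P X]setIT -integral_indic.
pose upd (B : set R) i := if i == k then \1_B else f i.
pose h w := \prod_(i | i != k) f i (X i w).
have h0 w : 0 <= h w by apply: prodr_ge0.
have mfX i : measurable_fun setT (fun w => f i (X i w)).
  by apply: measurableT_comp.
have mh : measurable_fun setT h.
  rewrite /h; under eq_fun do rewrite -big_filter.
  by apply: measurable_prod => i _.
have fX0 i : (0 <= \int[P]_w (f i (X i w))%:E)%E.
  by apply: integral_ge0 => w _; rewrite lee_fin.
pose c := (\prod_(i | i != k) fine (\int[P]_w (f i (X i w))%:E)%E) : R.
have c0 : 0 <= c by apply: prodr_ge0 => i _; apply: fine_ge0.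
have cE : (c%:E = \prod_(i | i != k) \int[P]_w (f i (X i w))%:E)%E.
  rewrite /c -prodEFin; apply: eq_bigr => i _.
  by rewrite fineK// ge0_fin_numE.
have hB (B : set R) : measurable B ->
    (c%:E * distribution P (X k) B = \int[P]_w (\1_B (X k w) * h w)%:E)%E.
  move=> mB.
  have updk : upd B k = \1_B by rewrite /upd eqxx.
  have updN i : i != k -> upd B i = f i by rewrite /upd => /negbTE ->.
  have mXB : measurable (X k @^-1` B).
    by rewrite -[_ @^-1` _]setTI; exact: measurable_funPT.
  have intk : (\int[P]_w (\1_B (X k w))%:E = P (X k @^-1` B))%E.
    by rewrite -[in RHS](setIT (X k @^-1` B)) -integral_indic.
  transitivity (\prod_i \int[P]_w (upd B i (X i w))%:E)%E.
    rewrite (bigD1 k)//= updk intk cE muleC; congr (_ * _)%E.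
    by apply: eq_bigr => i ik; rewrite updN.
  rewrite -IH.
  - apply: eq_integral => w _; congr EFin; rewrite (bigD1 k)//= updk.
    by congr (_ * _); apply: eq_bigr => i ik; rewrite updN.
  - by move=> i; rewrite /upd; case: ifP => _ //; exact: measurable_indic.
  - by move=> i x; rewrite /upd; case: ifP => _ //; rewrite indicE.
  - move=> i; have [->|ik] := eqVneq i k; last by rewrite updN.
    rewrite updk intk; apply: le_lt_trans (probability_le1 P mXB) _.
    exact: ltry.
  - move=> i is'; have [->|ik] := eqVneq i k; first by rewrite updk; exists B.
    by rewrite updN//; apply: find; rewrite inE negb_or ik.
pose nu := mscale (NngNum c0) (distribution P (X k)).
have -> : (\int[P]_w (\prod_i f i (X i w))%:E =
    \int[P]_w (f k (X k w) * h w)%:E)%E.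
  by apply: eq_integral => w _; rewrite (bigD1 k).
rewrite (bigD1 k)//= -cE.
rewrite -(@ge0_integral_density _ _ _ _ R P nu (X k) h (f k))//.
have mfk : measurable_fun setT (EFin \o f k) by exact/measurable_EFinP.
rewrite ge0_integral_mscale//; last by move=> x _; rewrite lee_fin.
by rewrite muleC ge0_integral_distribution//; move=> x; rewrite lee_fin.
Qed.

End Independence.

(** * Gaussian tails *)

Section GaussianTail.
Context {dT : measure_display} {T : measurableType dT} {R : realType}
  {P : probability T R}.

Lemma standard_normal_mgf (X : {RV P >-> R}) (lambda : R) :
  standard_normal X ->
  (\int[P]_w (expR (lambda * X w))%:E = (expR (lambda ^+ 2 / 2))%:E)%E.
Proof.
move=> stdX.
have me : measurable_fun setT (fun x : R => expR (lambda * x)).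
  by apply: measurableT_comp => //; exact: measurable_funM.
transitivity (\int[distribution P X]_x (expR (lambda * x))%:E)%E.
  rewrite ge0_integral_distribution//.
  exact/measurable_EFinP.
rewrite (ge0_integral_normal_law (m := 0) (s := 1))//.
have n10 : (1 : R) != 0 by exact: oner_neq0.
(* Completing the square turns the tilted density into the density of mean
   [lambda]. *)
transitivity (\int[lebesgue_measure]_x ((expR (lambda ^+ 2 / 2))%:E *
   (normal_pdf lambda 1 x)%:E))%E.
  apply: eq_integral => x _; rewrite -EFinM; congr EFin.
  rewrite !normal_pdfE// /normal_fun mulrCA [RHS]mulrCA.
  congr (_ * _); rewrite -!expRD; congr expR.
  by rewrite expr1n; field.
rewrite ge0_integralZl//.
- by rewrite integral_normal_pdf mule1.
- apply/measurable_EFinP; exact: measurable_normal_pdf.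
- by move=> x _; rewrite lee_fin normal_pdf_ge0.
Qed.

(** Chernoff's bound, with the exponent [l = s / v] that minimizes
[- l s + l^2 v / 2]. *)
Lemma gaussian_linear_tail (I : finType) (X : I -> {RV P >-> R}) (a : I -> R)
    (v s : R) :
  iid_standard_normal X -> 0 < v -> \sum_i a i ^+ 2 <= v -> 0 <= s ->
  (P [set w | s < \sum_i a i * X i w]%R <= (expR (- (s ^+ 2 / (2 * v))))%:E)%E.
Proof.
move=> [indX stdX] v0 av s0.
pose S w : R := \sum_i a i * X i w.
have mS : measurable_fun setT S.
  by apply: measurable_sum => i; exact: measurable_funM.
have mA : measurable [set w | s < S w].
  by rewrite -[X in measurable X]setTI; exact: measurable_fun_ltr.
pose l := s / v.
have l0 : 0 <= l by rewrite divr_ge0// ltW.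
have mf i : measurable_fun setT (fun x : R => expR (l * a i * x)).
  by apply: measurableT_comp => //; exact: measurable_funM.
have Emgf i : (\int[P]_w (expR (l * a i * X i w))%:E =
    (expR ((l * a i) ^+ 2 / 2))%:E)%E by exact: standard_normal_mgf.
have -> : P [set w | s < S w] = (\int[P]_w (\1_[set w | s < S w] w)%:E)%E.
  by rewrite integral_indic// setIT.
apply: (@le_trans _ _ (\int[P]_w
    ((expR (- (l * s)))%:E * (\prod_i expR (l * a i * X i w))%:E))%E).
  apply: ge0_le_integral => //.
  - exact/measurable_EFinP.
  - under eq_fun do rewrite -EFinM.
    apply/measurable_EFinP; apply: measurable_funM => //.
    apply: measurable_prod => i _.
    by apply: measurableT_comp => //; exact: measurable_funM.
  - move=> w _; rewrite -EFinM lee_fin -expR_sum -expRD.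
    rewrite (eq_bigr (fun i => l * (a i * X i w))); last first.
      by move=> i _; rewrite mulrA.
    rewrite -mulr_sumr -/(S w) -mulrN1 -mulrA -mulrDr mulrN1 indicE.
    case: (boolP (w \in _)) => [|_]; last exact: expR_ge0.
    rewrite inE/= => sS; rewrite -[leLHS]expR0 ler_expR mulr_ge0//.
    by rewrite addrC subr_ge0 ltW.
rewrite ge0_integralZl//; last 2 first.
- apply/measurable_EFinP; apply: measurable_prod => i _.
  by apply: measurableT_comp => //; exact: measurable_funM.
- by move=> w _; rewrite lee_fin prodr_ge0// => i _; exact: expR_ge0.
rewrite (@expectation_prod_indep _ _ _ _ _ X (fun i x => expR (l * a i * x)))//; last first.
  by move=> i; rewrite Emgf ltry.
under eq_bigr do rewrite Emgf.
rewrite prodEFin -EFinM lee_fin -expR_sum -expRD ler_expR.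
rewrite (eq_bigr (fun i => l ^+ 2 / 2 * a i ^+ 2)); last by move=> i _; field.
rewrite -mulr_sumr.
have vN0 : v != 0 by rewrite gt_eqF.
apply: (@le_trans _ _ (- (l * s) + l ^+ 2 / 2 * v)).
  by rewrite lerD2l ler_wpM2l// divr_ge0// sqr_ge0.
by rewrite /l le_eqVlt; apply/orP; left; apply/eqP; field.
Qed.

End GaussianTail.

Section UnionBound.
Context {dT : measure_display} {T : measurableType dT} {R : realType}
  {P : probability T R}.

Lemma union_bound_const (J : finType) (A : J -> set T) (x : R) :
  (forall j, measurable (A j)) -> (forall j, (P (A j) <= x%:E)%E) ->
  (P (\bigcup_j A j) <= (#|J|%:R * x)%:E)%E.
Proof.
move=> mA Ax.
apply: (@le_trans _ _ (\sum_(j \in [set: J]) P (A j))%E).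
  have finJ : finite_set [set: J] by exact: finite_finset.
  apply: content_sub_fsum => //.
  by apply: fin_bigcup_measurable => // j _; exact: mA.
have -> : (\sum_(j \in [set: J]) P (A j) = \sum_(j <- enum J) P (A j))%E.
  have -> : [set: J] = [set` enum J].
    by apply/seteqP; split => j _ //=; rewrite mem_enum.
  by rewrite -fsbig_seq ?enum_uniq.
rewrite big_enum/= (@le_trans _ _ (\sum_(j : J) x%:E)%E)//.
  by apply: lee_sum.
by rewrite sumEFin sumr_const [X in (_ <= X%:E)%E]mulr_natl.
Qed.

Lemma gaussian_net_tail (I J : finType) (X : I -> {RV P >-> R}) (a : J -> I -> R)
    (v s : R) :
  iid_standard_normal X -> 0 < v -> (forall j, \sum_i a j i ^+ 2 <= v) -> 0 <= s ->
  (P (\bigcup_j [set w | (s < \sum_i a j i * X i w)%R]) <=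
    (#|J|%:R * expR (- (s ^+ 2 / (2 * v))))%:E)%E.
Proof.
move=> iid v0 av s0; apply: union_bound_const => j.
  rewrite -[X in measurable X]setTI; apply: measurable_fun_ltr => //.
  by apply: measurable_sum => i; exact: measurable_funM.
exact: gaussian_linear_tail.
Qed.

Lemma gaussian_max_tail (I : finType) (X : I -> {RV P >-> R}) (s : R) :
  iid_standard_normal X -> 0 <= s ->
  (P (\bigcup_i [set w | (s < `|X i w|)%R]) <=
    (2 * #|I|%:R * expR (- (s ^+ 2 / 2)))%:E)%E.
Proof.
move=> iid s0.
(* [|X i|] is the largest of the linear combinations [X i] and [- X i]. *)
pose a (j : bool * I) i : R := (-1) ^+ j.1 * (i == j.2)%:R.
have aX j w : \sum_i a j i * X i w = (-1) ^+ j.1 * X j.2 w.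
  rewrite (bigD1 j.2)//= {1}/a eqxx mulr1 big1 ?addr0// => i /negbTE ij.
  by rewrite /a ij mulr0 mul0r.
have a1 j : \sum_i a j i ^+ 2 <= 1.
  rewrite (bigD1 j.2)//= {1}/a eqxx mulr1 -exprM mulnC exprM sqrrN expr1n expr1n.
  by rewrite big1 ?addr0// => i /negbTE ij; rewrite /a ij mulr0 expr0n.
have := gaussian_net_tail iid ltr01 a1 s0.
rewrite card_prod card_bool natrM mulr1; congr (P _ <= _)%E.
apply/seteqP; split => w /=.
  by move=> [j _ /=]; rewrite aX => h; exists j.2 => //=; move: h; case: j.1;
    rewrite ?expr1 ?expr0 ?mulN1r ?mul1r => h; rewrite (lt_le_trans h)// ?ler_norm//
    -normrN ler_norm.
move=> [i _ /=]; rewrite ltr_normr => /orP[h|h].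
  by exists (false, i) => //=; rewrite aX mul1r.
by exists (true, i) => //=; rewrite aX expr1 mulN1r.
Qed.

End UnionBound.

(** * Measurability of the supremum *)

(** Monotonicity of the probability is available for measurable events only. The
supremum ranges over an uncountable set, but the tensors at which it
exceeds [c] form an open set, hence a countable union of cubes with rational
centres: those on which a single [V] of [D] witnesses the inequality. *)
Lemma measurable_sup_frob_inner {R : realType} {m d : nat}
    {dT : measure_display} {T : measurableType dT} {P : probability T R}
    (N : {ffun 'I_d -> 'I_m} -> {RV P >-> R}) (D : set (tensor R m d)) (c : R) :
  measurable [set w |
    (c%:E < ereal_sup [set (frob_inner (random_tensor N w) V)%:E | V in D])%E].
Proof.
pose I : finType := {ffun 'I_d -> 'I_m}.
pose near (q : {ffun I -> rat}) (k : nat) (A : tensor R m d) :=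
  forall i, `|A i - ratr (q i)| < k.+1%:R^-1.
pose good (qk : {ffun I -> rat} * nat) :=
  exists2 V, D V & forall A, near qk.1 qk.2 A -> c < frob_inner A V.
rewrite (_ : [set w | _] =
    \bigcup_(qk in good) [set w | near qk.1 qk.2 (random_tensor N w)]).
  rewrite bigcup_mkcond; apply: countable_bigcupT_measurable => [|[q k]].
    exact: countableP.
  case: ifP => // _ /=; rewrite (_ : [set w | _] = \bigcap_(i in [set: I])
      [set w | `|N i w - ratr (q i)| < k.+1%:R^-1]); last first.
    apply/seteqP; split=> w /= h i; first by move=> _; have := h i; rewrite ffunE.
    by rewrite ffunE; exact: h.
  apply: fin_bigcap_measurable => // i _.
  rewrite -[X in measurable X]setTI; apply: measurable_fun_ltr => //.
  apply: measurableT_comp => //; exact: measurable_funB.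
apply/seteqP; split => w /=; last first.
  move=> [[q k] [V DV /= qV] /= wq]; apply: lt_le_trans (_ : _ < (frob_inner (random_tensor N w) V)%:E)%E _.
    by rewrite lte_fin; exact: qV.
  by apply: ereal_sup_ubound; exists V.
move=> /ereal_sup_gt[_ [V DV <-]]; rewrite lte_fin.
set A := random_tensor N w => cA.
pose B : R := \sum_i `|V i| + 1.
have B0 : 0 < B by rewrite ltr_wpDl// sumr_ge0.
(* Two points of a cube of half-side below [e] differ by at most [2 e] in each
   entry, so their inner products with [V] differ by less than
   [frob_inner A V - c]. *)
pose e := (frob_inner A V - c) / (2 * B).
have e0 : 0 < e by rewrite divr_gt0// ?subr_gt0// mulr_gt0.
have [k ke] : exists k, k.+1%:R^-1 < e.
  exists (Num.truncn e^-1); rewrite -[ltRHS]invrK ltf_pV2 ?posrE ?invr_gt0//.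
  exact: truncnS_gt.
have /choice[q qA] : forall i, exists r : rat, `|A i - ratr r| < k.+1%:R^-1.
  move=> i; have k0 : 0 < k.+1%:R^-1 :> R by rewrite invr_gt0.
  move: k0; set del := _^-1 => k0.
  have [|r] := @rat_in_itvoo R (A i - del) (A i + del); first by lra.
  by rewrite in_itv/= => /andP[? ?]; exists r; rewrite ltr_distl; lra.
exists ([ffun i => q i], k).
  exists V => // A' /= A'q.
  have AA' : forall i, `|A i - A' i| <= 2 * e.
    move=> i; have := A'q i; rewrite ffunE => A'qi.
    rewrite (le_trans (ler_distD (ratr (q i)) _ _))//.
    rewrite [`|ratr _ - _|]distrC; have := qA i; move: A'qi ke; set del := _^-1; lra.
  have : `|frob_inner A V - frob_inner A' V| <= 2 * e * \sum_i `|V i|.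
    rewrite /frob_inner -sumrB mulr_sumr (le_trans (ler_norm_sum _ _ _))//.
    by apply: ler_sum => i _; rewrite -mulrBl normrM ler_wpM2r.
  have -> : \sum_i `|V i| = B - 1 by rewrite /B addrK.
  have -> : 2 * e * (B - 1) = (frob_inner A V - c) - 2 * e.
    by rewrite /e; field; rewrite gt_eqF.
  by rewrite ler_norml => /andP[_]; lra.
move=> i /=; rewrite [X in ratr X]ffunE; exact: qA.
Qed.

(** * A bounded parametrization of unit tensors of rank at most 2 *)

Lemma ler_dist_prod {R : realType} (I : finType) (a b : I -> R) (eta : R) :
  (forall i, `|a i| <= 1) -> (forall i, `|b i| <= 1) ->
  (forall i, `|a i - b i| <= eta) ->
  `|\prod_i a i - \prod_i b i| <= #|I|%:R * eta.
Proof.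
move=> a1 b1 abeta.
rewrite cardT.
have prod1 (s : seq I) (x : I -> R) : (forall i, `|x i| <= 1) ->
    `|\prod_(i <- s) x i| <= 1.
  move=> x1; rewrite normr_prod; elim: s => [|i s IH]; first by rewrite big_nil.
  by rewrite big_cons mulr_ile1// prodr_ge0.
have -> : \prod_i a i = \prod_(i <- enum I) a i by rewrite big_enum.
have -> : \prod_i b i = \prod_(i <- enum I) b i by rewrite big_enum.
elim: (enum I) => [|i s IH]; first by rewrite !big_nil subrr normr0 mul0r.
rewrite !big_cons.
have -> : a i * \prod_(j <- s) a j - b i * \prod_(j <- s) b j =
   (a i - b i) * \prod_(j <- s) a j
   + b i * (\prod_(j <- s) a j - \prod_(j <- s) b j) by ring.
rewrite (le_trans (ler_normD _ _))//= -natr1 [leRHS]mulrDl mul1r [leRHS]addrC.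
rewrite lerD// normrM.
  by rewrite -[leRHS]mulr1 ler_pM// prod1.
by rewrite -[leRHS]mul1r ler_pM.
Qed.

Section Chart.
Context {R : realType} {m d : nat}.
Implicit Types (a b u v y p : 'I_d -> 'rV[R]_m).

Lemma frob_inner_elementary a b :
  frob_inner (elementary a) (elementary b) =
  \prod_s \sum_j a s ord0 j * b s ord0 j.
Proof.
rewrite bigA_distr_bigA/=; apply: eq_bigr => i _.
by rewrite !ffunE -big_split.
Qed.

Definition splice v y p (s r : 'I_d) : 'rV[R]_m :=
  if (r < s)%N then v r else if r == s then y r else p r.

(** The product of the [u s], plus what results from telescoping: in the [s]-th
term the factors before [s] come from [v], those after [s] from [p]. *)
Definition rank2_chart u v y p : tensor R m d :=
  elementary u + \sum_s elementary (splice v y p s).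

Lemma rank2_chartE u v y p i :
  rank2_chart u v y p i =
  elementary u i + \sum_s elementary (splice v y p s) i.
Proof. by rewrite [LHS]ffunE sum_ffunE. Qed.

(** The hybrid products, with factors [v] up to some index and [p] beyond it,
interpolate between the two products; consecutive ones differ in one factor. *)
Lemma elementary_sub v p (beta : R) :
  beta *: (elementary v - elementary p) =
  \sum_s elementary (splice v (fun s => beta *: (v s - p s)) p s) :> tensor R m d.
Proof.
apply/ffunP => i; rewrite sum_ffunE !ffunE/=.
pose t k := \prod_(r < d) (if (r < k)%N then v r ord0 (i r) else p r ord0 (i r)).
have -> : \prod_s v s ord0 (i s) = t d.
  by apply: eq_bigr => r _; rewrite ltn_ord.
have -> : \prod_s p s ord0 (i s) = t 0%N by [].
rewrite -(@telescope_sumr _ 0 d t)// big_mkord scaler_sumr.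
apply: eq_bigr => s _; rewrite /t !ffunE (bigD1 s)//= ltnSn.
rewrite [X in _ - X](bigD1 s)//= ltnn [RHS](bigD1 s)//= /splice ltnn eqxx.
rewrite !mxE/=.
have -> : \prod_(r | r != s) (if (r < s.+1)%N then v r ord0 (i r) else p r ord0 (i r))
    = \prod_(r | r != s) (if (r < s)%N then v r ord0 (i r) else p r ord0 (i r)).
  apply: eq_bigr => r rs; rewrite ltnS leq_eqVlt.
  by rewrite (_ : (r == s :> nat) = false)//; exact/negbTE.
rewrite -mulrBl /GRing.scale/= mulrA; congr (_ * _).
by apply: eq_bigr => r /negbTE rs; rewrite rs; case: ifP.
Qed.

Definition entries_le1 a := forall s j, `|a s ord0 j| <= 1.

Lemma entries_le1_splice v y p s :
  entries_le1 v -> entries_le1 y -> entries_le1 p -> entries_le1 (splice v y p s).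
Proof. by move=> v1 y1 p1 r j; rewrite /splice; case: ifP => // _; case: ifP. Qed.

Lemma ler_dist_elementary a b (eta : R) i :
  entries_le1 a -> entries_le1 b ->
  (forall s j, `|a s ord0 j - b s ord0 j| <= eta) ->
  `|elementary a i - elementary b i| <= d%:R * eta.
Proof.
move=> a1 b1 ab; rewrite !ffunE -[in leRHS](card_ord d).
exact: ler_dist_prod.
Qed.

Lemma ler_dist_rank2_chart u v y p u' v' y' p' (eta : R) i :
  entries_le1 u -> entries_le1 v -> entries_le1 y -> entries_le1 p ->
  entries_le1 u' -> entries_le1 v' -> entries_le1 y' -> entries_le1 p' ->
  (forall s j, `|u s ord0 j - u' s ord0 j| <= eta) ->
  (forall s j, `|v s ord0 j - v' s ord0 j| <= eta) ->
  (forall s j, `|y s ord0 j - y' s ord0 j| <= eta) ->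
  (forall s j, `|p s ord0 j - p' s ord0 j| <= eta) ->
  `|rank2_chart u v y p i - rank2_chart u' v' y' p' i| <=
    (d.+1 * d)%:R * eta.
Proof.
move=> u1 v1 y1 p1 u1' v1' y1' p1' uu vv yy pp.
rewrite !rank2_chartE opprD addrACA -sumrB.
rewrite (le_trans (ler_normD _ _))// mulSn natrD mulrDl lerD//.
  by apply: ler_dist_elementary.
rewrite (le_trans (ler_norm_sum _ _ _))// (natrM _ d d) -mulrA.
apply: (@le_trans _ _ (\sum_(s < d) d%:R * eta)); last first.
  by rewrite sumr_const card_ord [leRHS]mulr_natl.
apply: ler_sum => s _; apply: ler_dist_elementary => [||r j].
- exact: entries_le1_splice.
- exact: entries_le1_splice.
by rewrite /splice; case: ifP => _ //; case: ifP => _.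
Qed.

End Chart.

Section Cover.
Context {R : realType} {m d : nat}.
Implicit Types (x z : 'rV[R]_m) (a b u v y p : 'I_d -> 'rV[R]_m) (V : tensor R m d).

Definition dotr x z : R := \sum_j x ord0 j * z ord0 j.

Lemma dotr_ge0 x : 0 <= dotr x x.
Proof. by apply: sumr_ge0 => j _; rewrite -expr2 sqr_ge0. Qed.

Lemma dotr_eq0 x : dotr x x = 0 -> x = 0.
Proof.
move=> /eqP; rewrite psumr_eq0; last by move=> j _; rewrite -expr2 sqr_ge0.
move=> /allP x0; apply/rowP => j; rewrite mxE.
by have := x0 j (mem_index_enum _); rewrite /= -expr2 sqrf_eq0 => /eqP.
Qed.

Lemma entry_le1 x j : dotr x x <= 1 -> `|x ord0 j| <= 1.
Proof.
move=> x1; rewrite -(@expr_le1 _ 2)// real_normK ?num_real//.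
apply: le_trans x1; rewrite /dotr (bigD1 j)//= -expr2 lerDl.
by apply: sumr_ge0 => k _; rewrite -expr2 sqr_ge0.
Qed.

Lemma dotr_sub_proj x z (c beta : R) :
  dotr x x = 1 -> dotr z z = 1 -> dotr x z = c ->
  dotr (beta *: (z - c *: x)) (beta *: (z - c *: x)) = beta ^+ 2 * (1 - c ^+ 2).
Proof.
move=> x1 z1 xz.
have -> : beta ^+ 2 * (1 - c ^+ 2) =
    beta ^+ 2 * (dotr z z - 2 * c * dotr x z + c ^+ 2 * dotr x x).
  by rewrite x1 z1 xz; ring.
rewrite /dotr !mulr_sumr -sumrB -big_split/= mulr_sumr.
by apply: eq_bigr => j _; rewrite !mxE; ring.
Qed.

Lemma dotr_unit_sqr_le1 x z :
  dotr x x = 1 -> dotr z z = 1 -> dotr x z ^+ 2 <= 1.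
Proof.
move=> x1 z1; have := dotr_ge0 (1 *: (z - dotr x z *: x)).
by rewrite (dotr_sub_proj 1 x1 z1 erefl) expr1n mul1r subr_ge0.
Qed.

(** A vanishing [a s] is [0] times an arbitrary unit vector. *)
Lemma elementary_unit a : (0 < m)%N ->
  exists (alpha : R) u,
    elementary a = alpha *: elementary u /\ forall s, dotr (u s) (u s) = 1.
Proof.
move=> m0; pose n s := Num.sqrt (dotr (a s) (a s)).
pose u s := if n s == 0 then delta_mx ord0 (Ordinal m0) else (n s)^-1 *: a s.
exists (\prod_s n s), u; split.
  apply/ffunP => i; rewrite !ffunE/= /GRing.scale/= -big_split/=.
  apply: eq_bigr => s _; rewrite /u; case: ifPn => [|ns]; last first.
    by rewrite mxE mulVKf.
  move=> n0; have a0 : a s = 0.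
    apply: dotr_eq0; apply/eqP; rewrite eq_le dotr_ge0 andbT.
    by rewrite -sqrtr_eq0.
  by rewrite (eqP n0) mul0r a0 mxE.
move=> s; rewrite /u; case: ifPn => [_|ns].
  rewrite /dotr (bigD1 (Ordinal m0))//= big1 => [|j /negbTE j0].
    by rewrite !mxE !eqxx mulr1 addr0.
  by rewrite !mxE eqxx j0 mulr0.
rewrite /dotr (eq_bigr (fun j => (n s) ^- 2 * (a s ord0 j * a s ord0 j))).
  by rewrite -mulr_sumr -/(dotr _ _) -[dotr _ _]sqr_sqrtr ?dotr_ge0// mulVf// expf_neq0.
by move=> j _; rewrite !mxE; field.
Qed.

Lemma elementary0 : (0 < d)%N -> elementary (fun=> 0) = 0 :> tensor R m d.
Proof.
move=> d0; apply/ffunP => i; rewrite !ffunE.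
by rewrite (bigD1 (Ordinal d0))//= mxE mul0r.
Qed.

Lemma elementary_scale_first (s0 : 'I_d) (g : R) u :
  elementary (fun s => (if s == s0 then g else 1) *: u s) = g *: elementary u.
Proof.
apply/ffunP => i; rewrite !ffunE/= /GRing.scale/= (bigD1 s0)//= eqxx mxE.
rewrite [in RHS](bigD1 s0)//= -mulrA; congr (_ * (_ * _)).
by apply: eq_bigr => s /negbTE ss0; rewrite mxE ss0 mul1r.
Qed.

Lemma rank2_sum_elementary V : (0 < d)%N -> (canonical_rank V <= 2)%N ->
  exists a b, V = elementary a + elementary b.
Proof.
move=> d0 V2; have [[w ->] _] := canonical_rankP V d0.
move: (canonical_rank V) V2 w => [|[|[|//]]] _ w.
- by exists (fun=> 0), (fun=> 0); rewrite big_ord0 elementary0// addr0.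
- by exists (w ord0), (fun=> 0); rewrite big_ord_recl big_ord0 elementary0.
- exists (w ord0), (w (lift ord0 ord0)).
  by rewrite !big_ord_recl big_ord0 addr0.
Qed.

(** The coefficients of the two elementary terms of [V] are unbounded when these
terms are almost parallel, but then each [v s] is close to its projection on
[u s], and [y s] stays bounded: [1 - c s ^+ 2 <= 1 - C ^+ 2], and the unit norm
of [V] bounds [be ^+ 2 * (1 - C ^+ 2)] by 1. *)
Lemma rank2_chart_cover V :
  (0 < m)%N -> (0 < d)%N -> (canonical_rank V <= 2)%N -> frob_norm V = 1 ->
  exists u v y p, [/\ V = rank2_chart u v y p,
    entries_le1 u, entries_le1 v, entries_le1 y & entries_le1 p].
Proof.
move=> m0 d0 /(rank2_sum_elementary d0)[a [b VE]] V1.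
have [al [u [aE u1]]] := elementary_unit a m0.
have [be [v [bE v1]]] := elementary_unit b m0.
rewrite {a}aE {b}bE in VE.
pose c s := dotr (u s) (v s).
pose C := \prod_s c s.
have UU : frob_inner (elementary u) (elementary u) = 1.
  by rewrite frob_inner_elementary big1// => s _; exact: u1.
have WW : frob_inner (elementary v) (elementary v) = 1.
  by rewrite frob_inner_elementary big1// => s _; exact: v1.
have UW : frob_inner (elementary u) (elementary v) = C.
  by rewrite frob_inner_elementary.
have norm1 : (al + be * C) ^+ 2 + be ^+ 2 * (1 - C ^+ 2) = 1.
  have VV : frob_inner V V = 1.
    have V0 : 0 <= frob_inner V V.
      by apply: sumr_ge0 => i _; rewrite -expr2 sqr_ge0.
    by rewrite -(sqr_sqrtr V0) -/(frob_norm V) V1 expr1n.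
  rewrite -[RHS]VV.
  transitivity (al ^+ 2 * frob_inner (elementary u) (elementary u)
    + 2 * al * be * frob_inner (elementary u) (elementary v)
    + be ^+ 2 * frob_inner (elementary v) (elementary v)).
    by rewrite UU UW WW; ring.
  rewrite /frob_inner !mulr_sumr -!big_split/=; apply: eq_bigr => i _.
  rewrite VE.
  have -> : (al *: elementary u + be *: elementary v) i =
    al * elementary u i + be * elementary v i by rewrite !ffunE.
  ring.
have c1 s : c s ^+ 2 <= 1 by exact: dotr_unit_sqr_le1.
have Cc s : C ^+ 2 <= c s ^+ 2.
  rewrite /C (bigD1 s)//= exprMn ler_piMr ?sqr_ge0// -prodrXl.
  by apply: prodr_ile1 => r _; rewrite sqr_ge0 c1.
pose p s := c s *: u s.
pose y s := be *: (v s - p s).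
(* The scalar [g] is absorbed in the vector of index [s0]. *)
pose g := al + be * C.
pose s0 : 'I_d := Ordinal d0.
have C1 : C ^+ 2 <= 1 by exact: le_trans (Cc s0) (c1 s0).
have g1 : `|g| <= 1.
  rewrite -(@expr_le1 _ 2)// real_normK ?num_real// -norm1 lerDl.
  by rewrite mulr_ge0 ?sqr_ge0// subr_ge0.
have u1' : entries_le1 u by move=> s j; apply: entry_le1; rewrite u1.
exists (fun s => (if s == s0 then g else 1) *: u s), v, y, p; split.
- rewrite /rank2_chart elementary_scale_first -elementary_sub VE.
  have -> : elementary p = C *: elementary u.
    apply/ffunP => i; rewrite !ffunE/= /GRing.scale/= -big_split/=.
    by apply: eq_bigr => s _; rewrite mxE.
  rewrite scalerBr scalerA /g scalerDl -!addrA; congr (_ + _).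
  by rewrite addrCA subrr addr0.
- move=> s j; rewrite mxE normrM mulr_ile1//.
  by case: ifP => // _; rewrite normr1.
- by move=> s j; apply: entry_le1; rewrite v1.
- move=> s j; apply: entry_le1; rewrite dotr_sub_proj//.
  apply: (@le_trans _ _ (be ^+ 2 * (1 - C ^+ 2))).
    by rewrite ler_wpM2l ?sqr_ge0// lerD2l lerN2.
  by rewrite -[leRHS]norm1 lerDr sqr_ge0.
- move=> s j; rewrite mxE normrM mulr_ile1//.
  by rewrite -(@expr_le1 _ 2)// real_normK ?num_real.
Qed.

End Cover.

(** * A finite net of tensors *)

(** Half the number of steps of the grid on [[-1, 1]]. The fourth power is what
[sup_low_rank_le_net] requires: with [n = m ^ d], one factor [n] for the number
of entries of a tensor, one for the size of those of the random tensor, and two for the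
[d.+1 * d <= n ^ 2] roundings in each entry of [rank2_chart]. *)
Definition net_mesh (m d : nat) : nat := (2 * (m ^ d) ^ 4)%N.

Definition net_index (m d : nat) : finType :=
  ('M['I_(2 * net_mesh m d).+1]_(d, m) * 'M['I_(2 * net_mesh m d).+1]_(d, m) *
   'M['I_(2 * net_mesh m d).+1]_(d, m) * 'M['I_(2 * net_mesh m d).+1]_(d, m))%type.

Section Net.
Context {R : realType} {m d : nat}.
Implicit Types (V A : tensor R m d) (a : 'I_d -> 'rV[R]_m).

Definition grid_point (M : nat) (g : 'M['I_(2 * M).+1]_(d, m)) (s : 'I_d) :
  'rV[R]_m := \row_j ((g s j)%:R / M%:R - 1).

Lemma grid_point_le1 M (g : 'M['I_(2 * M).+1]_(d, m)) :
  (0 < M)%N -> entries_le1 (grid_point g).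
Proof.
move=> M0 s j; rewrite mxE.
have M0' : 0 < M%:R :> R by rewrite ltr0n.
have gM : (g s j)%:R <= 2 * M%:R :> R.
  by rewrite -natrM ler_nat -ltnS ltn_ord.
have : (g s j)%:R / M%:R <= 2 :> R by rewrite ler_pdivrMr.
have : 0 <= (g s j)%:R / M%:R :> R by rewrite divr_ge0.
by rewrite ler_norml => ? ?; apply/andP; split; lra.
Qed.

Lemma grid_point_near M a : (0 < M)%N -> entries_le1 a ->
  exists g : 'M['I_(2 * M).+1]_(d, m),
    forall s j, `|a s ord0 j - grid_point g s ord0 j| <= M%:R^-1.
Proof.
move=> M0 a1.
have M0' : 0 < M%:R :> R by rewrite ltr0n.
exists (\matrix_(s, j) inord (Num.truncn ((a s ord0 j + 1) * M%:R))) => s j.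
rewrite !mxE; have := a1 s j; move: (a s ord0 j) => x.
rewrite ler_norml => /andP[x1 x2].
have xM0 : 0 <= (x + 1) * M%:R by rewrite mulr_ge0//; lra.
have /andP[kx xk] := truncn_itv xM0; move: kx xk.
set k := Num.truncn _ => kx xk.
have k2M : (k <= 2 * M)%N.
  rewrite -(ler_nat R) natrM (le_trans kx)// ler_wpM2r//; lra.
rewrite inordK ?ltnS//.
have -> : x - (k%:R / M%:R - 1) = ((x + 1) * M%:R - k%:R) / M%:R.
  by field; rewrite gt_eqF.
rewrite normrM normfV [`|M%:R|]ger0_norm ?(ltW M0')// -[leRHS]mul1r.
rewrite ler_wpM2r ?invr_ge0 ?(ltW M0')// ger0_norm ?subr_ge0//.
by rewrite lerBlDl natr1 ltW.
Qed.

Definition net (g : net_index m d) : tensor R m d :=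
  rank2_chart (grid_point g.1.1.1) (grid_point g.1.1.2) (grid_point g.1.2)
    (grid_point g.2).

Lemma card_net_index : (1 < m)%N -> (0 < d)%N ->
  (#|net_index m d| <= m ^ (28 * (m * d ^ 2)))%N.
Proof.
move=> m1 d0; rewrite !card_prod !card_mx card_ord -!expnD.
have n2 : (2 <= m ^ d)%N by rewrite (leq_trans m1)// -{1}(expn1 m) leq_exp2l.
have mesh7 : ((2 * net_mesh m d).+1 <= (m ^ d) ^ 7)%N.
  rewrite /net_mesh; move: (m ^ d)%N n2 => n n2.
  have n4 : (0 < n ^ 4)%N by rewrite expn_gt0 (leq_trans _ n2).
  have n3 : (2 ^ 3 <= n ^ 3)%N by rewrite leq_exp2r.
  by rewrite (expnD n 4 3); nia.
apply: (@leq_trans (((m ^ d) ^ 7) ^ (d * m + d * m + d * m + d * m))).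
  by rewrite leq_exp2r// !addn_gt0 muln_gt0 d0 (ltnW m1).
by rewrite -!expnM leq_exp2l//; nia.
Qed.

(** Grid points carry no exact norm, so unit tensors are approximated by points
of squared norm at most 2; the factor 2 is the one between the Gaussian exponent
[s^2 / 2] and the exponent [t^2 / 4] to be reached. *)
Lemma net_approx V : (1 < m)%N -> (0 < d)%N ->
  (canonical_rank V <= 2)%N -> frob_norm V = 1 ->
  exists2 g : net_index m d, frob_inner (net g) (net g) <= 2 &
    forall i, `|V i - net g i| <= (2 * (m ^ d)%:R ^+ 2)^-1.
Proof.
move=> m1 d0 V2 V1.
have [u [v [y [p [VE u1 v1 y1 p1]]]]] := rank2_chart_cover (ltnW m1) d0 V2 V1.
set n := (m ^ d)%N.
have n2 : (2 <= n)%N by rewrite (leq_trans m1)// -{1}(expn1 m) leq_exp2l.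
have M0 : (0 < net_mesh m d)%N by rewrite muln_gt0/= expn_gt0 (leq_trans _ n2).
have [gu ugu] := grid_point_near M0 u1.
have [gv vgv] := grid_point_near M0 v1.
have [gy ygy] := grid_point_near M0 y1.
have [gp pgp] := grid_point_near M0 p1.
pose g : net_index m d := (gu, gv, gy, gp).
have nR : 2 <= n%:R :> R by rewrite ler_nat.
have n0 : 0 < n%:R :> R by lra.
have Vg i : `|V i - net g i| <= (2 * n%:R ^+ 2)^-1.
  rewrite VE; apply: (@le_trans _ _ ((d.+1 * d)%:R * (net_mesh m d)%:R^-1)).
    by apply: ler_dist_rank2_chart => //; exact: grid_point_le1.
  have -> : (net_mesh m d)%:R^-1 = (n ^ 2)%:R^-1 * (2 * n%:R ^+ 2)^-1 :> R.
    have inv4 (x : R) : x != 0 -> (2 * x ^+ 4)^-1 = (x ^+ 2)^-1 * (2 * x ^+ 2)^-1.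
      by move=> x0; field.
    have nN0 : n%:R != 0 :> R by rewrite gt_eqF.
    by rewrite /net_mesh -/n natrM (natrX _ n 4) (natrX _ n 2) -(inv4 _ nN0).
  rewrite mulrA ler_piMl ?invr_ge0 ?mulr_ge0 ?sqr_ge0//.
  have n2_gt0 : (0 < n ^ 2)%N by rewrite expn_gt0 (leq_trans _ n2).
  rewrite ler_pdivrMr ?ltr0n// mul1r.
  have dn : (d < n)%N by exact: ltn_expl.
  by rewrite ler_nat leq_mul// ltnW.
exists g => //.
have VV : frob_inner V V = 1.
  have V0 : 0 <= frob_inner V V.
    by apply: sumr_ge0 => i _; rewrite -expr2 sqr_ge0.
  by rewrite -(sqr_sqrtr V0) -/(frob_norm V) V1 expr1n.
set e := (2 * n%:R ^+ 2)^-1 in Vg.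
apply: (@le_trans _ _ (\sum_i (3 / 2 * (V i * V i) + 3 * e ^+ 2))).
  apply: ler_sum => i _.
  have : (V i - net g i) ^+ 2 <= e ^+ 2.
    by rewrite -real_normK ?num_real// lerXn2r ?nnegrE// (le_trans _ (Vg i)).
  move: (V i) (net g i) => x z xz.
  (* [z^2 <= (1 + 1/2) x^2 + (1 + 2) (x - z)^2] *)
  have : 0 <= (x - 2 * (z - x)) ^+ 2 by exact: sqr_ge0.
  nra.
rewrite big_split/= -mulr_sumr -/(frob_inner V V) VV sumr_const.
rewrite card_ffun !card_ord -/n.
have -> : (3 * e ^+ 2) *+ n = 3 / 4 * (n%:R ^+ 3)^-1.
  by rewrite -mulr_natr /e; field; rewrite gt_eqF.
have : (n%:R ^+ 3)^-1 <= 2^-1 :> R.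
  rewrite lef_pV2 ?posrE ?exprn_gt0//.
  by rewrite (le_trans nR)// ler_eXnr//; lra.
lra.
Qed.

Lemma sup_low_rank_le_net A (s : R) : (1 < m)%N -> (0 < d)%N ->
  (forall i, `|A i| <= 2 * (m ^ d)%:R) ->
  (forall g : net_index m d, frob_inner (net g) (net g) <= 2 ->
     frob_inner A (net g) <= s) ->
  (sup_low_rank 2 A <= (s + 1)%:E)%E.
Proof.
move=> m1 d0 A2 As; apply: ub_ereal_sup => _ [V [V2 V1] <-].
have [g g2 Vg] := net_approx m1 d0 V2 V1.
rewrite lee_fin; have := As g g2; set n := (m ^ d)%N in A2 Vg *.
have n0 : 0 < n%:R :> R by rewrite ltr0n expn_gt0 (ltnW m1).
suff : frob_inner A V - frob_inner A (net g) <= 1 by lra.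
rewrite /frob_inner -sumrB.
apply: (@le_trans _ _
    (\sum_(i : {ffun 'I_d -> 'I_m}) 2 * n%:R * (2 * n%:R ^+ 2)^-1)).
  apply: ler_sum => i _; rewrite -mulrBr (le_trans (ler_norm _))// normrM.
  by rewrite ler_pM.
rewrite sumr_const card_ffun !card_ord -/n -mulr_natr le_eqVlt.
by apply/orP; left; apply/eqP; field; rewrite gt_eqF.
Qed.

End Net.

(** * Numerical estimates and conclusion *)

Lemma expR_half_le2 {R : realType} : expR (1 / 2) <= 2 :> R.
Proof.
have := @expR_ge1Dx R (- (1 / 2)); rewrite expRN => h.
have : 0 < expR (1 / 2) :> R by exact: expR_gt0.
move=> e0; rewrite -[leLHS]invrK -[leRHS]invrK lef_pV2 ?posrE ?invr_gt0//; lra.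
Qed.

Lemma natrX_expR {R : realType} (n k : nat) : (0 < n)%N ->
  (n ^ k)%:R = expR (k%:R * ln n%:R) :> R.
Proof. by move=> n0; rewrite expRM_natl lnK ?posrE ?ltr0n// natrX. Qed.

Lemma entry_tail_le {R : realType} (m d : nat) : (0 < m)%N ->
  2 * (m ^ d)%:R * expR (- ((2 * (m ^ d)%:R) ^+ 2 / 2)) <=
  2 * expR (- (m%:R `^ (d%:R / 2) / 8)) :> R.
Proof.
move=> m0; rewrite -mulrA ler_wpM2l//.
have m1 : 1 <= m%:R :> R by rewrite ler1n.
have pow_n : m%:R `^ (d%:R / 2) <= (m ^ d)%:R :> R.
  rewrite natrX -powR_mulrn//; apply: ler_powR => //.
  by have : 0 <= d%:R :> R by []; lra.
have n1 : 1 <= (m ^ d)%:R :> R by rewrite ler1n expn_gt0 m0.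
move: n1 pow_n; move: (m ^ d)%:R (m%:R `^ _) => n z n1 zn.
have nexp : n <= expR n by have := @expR_ge1Dx R n; lra.
apply: (@le_trans _ _ (expR n * expR (- ((2 * n) ^+ 2 / 2)))).
  by rewrite ler_wpM2r// expR_ge0.
by rewrite -expRD ler_expR; nra.
Qed.

(** [K] stands for the size of the net. With [x = sqrt (m d^2 ln m) >= 1], the
level is at least [11 x + t], whose square exceeds [t^2] by more than
[4 * 28 x^2]. *)
Lemma net_tail_le {R : realType} (m d : nat) (t K : R) :
  (1 < m)%N -> (0 < d)%N -> 0 <= t -> K <= (m ^ (28 * (m * d ^ 2)))%:R ->
  let s := 12 * Num.sqrt (m%:R * d%:R ^+ 2 * ln m%:R) + t - 1 in
  0 <= s /\ K * expR (- (s ^+ 2 / (2 * 2))) <= expR (- (t ^+ 2 / 4)).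
Proof.
move=> m1 d0 t0 Km; set L := m%:R * d%:R ^+ 2 * ln m%:R; cbv zeta.
have mR : 2 <= m%:R :> R by rewrite ler_nat.
have dR : 1 <= d%:R :> R by rewrite ler1n.
have lnm : 1 / 2 <= ln m%:R :> R.
  rewrite -ler_expR lnK ?posrE; last by lra.
  by rewrite (le_trans expR_half_le2).
have L1 : 1 <= L.
  have : 1 <= d%:R ^+ 2 :> R by rewrite exprn_ege1.
  by rewrite /L mulrAC => d21; rewrite mulr_ege1//; nra.
have sL : Num.sqrt L ^+ 2 = L by rewrite sqr_sqrtr//; lra.
have sL1 : 1 <= Num.sqrt L by rewrite -sqrtr1 ler_wsqrtr.
have KL : K <= expR (28 * L).
  rewrite (le_trans Km)// natrX_expR ?(ltnW m1)// ler_expR /L.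
  by rewrite (natrM _ 28) (natrM _ m) natrX !mulrA.
move: sL sL1 KL; move: (Num.sqrt L) => x xL x1 KL.
split; first by lra.
apply: (@le_trans _ _ (expR (28 * L) * expR (- ((12 * x + t - 1) ^+ 2 / (2 * 2))))).
  by rewrite ler_wpM2r// expR_ge0.
rewrite -expRD ler_expR.
suff : 112 * x ^+ 2 + t ^+ 2 <= (12 * x + t - 1) ^+ 2 by rewrite xL; lra.
by nra.
Qed.

Theorem theorem4p1 (R : realType) :
  exists mu : R, 0 < mu /\
    forall (m d : nat) (t : R), (0 < m)%N -> (0 < d)%N -> 0 <= t ->
    forall (dT : measure_display) (T : measurableType dT)
           (P : probability T R) (N : {ffun 'I_d -> 'I_m} -> {RV P >-> R}),
      iid_standard_normal N ->
      (P [set w | (mu * Num.sqrt (m%:R * d%:R ^+ 2 * ln m%:R) + t)%:E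
                  < sup_low_rank 2 (random_tensor N w)]
       <= (expR (- (t ^+ 2 / 4))
           + 2 * expR (- (m%:R `^ (d%:R / 2) / 8)))%:E)%E.
Proof.
exists 12; split; first by lra.
move=> m d t m0 d0 t0 dT T P N iid.
set thr := 12 * _ + t.
have mE : measurable [set w | (thr%:E < sup_low_rank 2 (random_tensor N w))%E].
  exact: measurable_sup_frob_inner.
(* For [m = 1] the right-hand side exceeds [2 exp (- 1 / 8) >= 1]. *)
have [m1|m1] := leqP m 1.
  have mR : m%:R = 1 :> R by apply/eqP; rewrite pnatr_eq1 eqn_leq m1.
  apply: le_trans (probability_le1 P mE) _; rewrite lee_fin mR powR1.
  have := @expR_ge1Dx R (- (1 / 8)); have := expR_ge0 (- (t ^+ 2 / 4)); lra.
pose J : finType := {g : net_index m d | frob_inner (@net R m d g) (net g) <= 2}.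
have Jcard : (#|J|%:R : R) <= (m ^ (28 * (m * d ^ 2)))%:R.
  rewrite ler_nat card_sig (leq_trans (max_card _))//; exact: card_net_index.
have [s0 netJ] := net_tail_le m1 d0 t0 Jcard.
set s := 12 * _ + t - 1 in s0 netJ.
pose netE := \bigcup_(j : J) [set w | s < \sum_i net (val j) i * N i w].
pose maxE := \bigcup_i [set w | 2 * (m ^ d)%:R < `|N i w|].
have mN : measurable netE.
  apply: fin_bigcup_measurable => [|j _]; first exact: finite_finset.
  rewrite -[X in measurable X]setTI; apply: measurable_fun_ltr => //.
  by apply: measurable_sum => i; exact: measurable_funM.
have mM : measurable maxE.
  apply: fin_bigcup_measurable => [|i _]; first exact: finite_finset.
  rewrite -[X in measurable X]setTI; apply: measurable_fun_ltr => //.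
  exact: measurableT_comp.
have PN : (P netE <= (expR (- (t ^+ 2 / 4)))%:E)%E.
  apply: le_trans (gaussian_net_tail iid (ltr0n R 2) _ s0) _.
    by move=> j; exact: (valP j).
  by rewrite lee_fin.
have PM : (P maxE <= (2 * expR (- (m%:R `^ (d%:R / 2) / 8)))%:E)%E.
  have n0 : 0 <= 2 * (m ^ d)%:R :> R by rewrite mulr_ge0.
  apply: le_trans (gaussian_max_tail iid n0) _.
  by rewrite lee_fin card_ffun !card_ord entry_tail_le.
apply: (@le_trans _ _ (P (netE `|` maxE))).
  apply: le_measure; rewrite ?inE//; first exact: measurableU.
  move=> w /= sup_big; apply: contrapT => /not_orP[wN wM].
  move: sup_big; apply/negP; rewrite -leNgt.
  have -> : thr = s + 1 by rewrite /s subrK.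
  apply: sup_low_rank_le_net => // [i|g g2].
    by rewrite ffunE leNgt; apply/negP => iw; apply: wM; exists i.
  rewrite leNgt; apply/negP => gw; apply: wN; exists (Sub g g2 : J) => //=.
  move: gw; rewrite /frob_inner (eq_bigr (fun i => net g i * N i w))// => i _.
  by rewrite [random_tensor _ _ _]ffunE mulrC.
rewrite EFinD; apply: le_trans (measureU2 _ mN mM) _.
exact: leeD.
Qed.
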